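(* Let $M$ be a strictly totally ordered monoid with $|M|\geq 2$ and let $R$ be an $M$-central Armendariz ring. Then $R$ is a right p.p.-ring if and only if $R[M]$ is a right p.p.-ring.
   Context: All rings are associative with identity. $C(R)$ denotes the center of a ring $R$, and $R[M]$ denotes the monoid ring of a monoid $M$ over $R$. A ring $R$ is called $M$-central Armendariz if whenever $\alpha=a_1g_1+\dots+a_mg_m\in R[M]$ and $\beta=b_1h_1+\dots+b_nh_n\in R[M]$ (with $a_i,b_j\in R$, $g_1,\dots,g_m\in M$ pairwise distinct, and $h_1,\dots,h_n\in M$ pairwise distinct) satisfy $\alpha\beta=0$, then $a_ib_j\in C(R)$ for all $1\le i\le m$ and $1\le j\le n$. A ring $S$ is a right p.p.-ring (right principal projective) if the right annihilator of each element of $S$ is generated, as a right ideal, by an idempotent, i.e. for each $a\in S$ there is an idempotent $f\in S$ with $\{s\in S: as=0\}=fS$. An ordered monoid $(M,\le)$ is strictly ordered if for all $g,g',h\in M$, $g<g'$ implies $gh<g'h$ and $hg<hg'$. It is strictly totally ordered if in addition $\le$ is a total order. *)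

(* Defs.v *)
From HB Require Import structures.
From mathcomp Require Import all_boot all_order all_algebra.
From mathcomp Require Import fingroup finmap monalg.

Set Implicit Arguments.
Unset Strict Implicit.
Unset Printing Implicit Defensive.

Import GRing.Theory.

Local Open Scope fset_scope.
Local Open Scope ring_scope.

(* Monotonicity for [<=] is not a separate axiom: it follows from these two,
   the case of equality being trivial. *)
HB.mixin Record isStrictlyOrderedMonoid (d : Order.disp_t) M
    of monoid.Monoid M & Order.POrder d M := {
  ltg_mul2r : forall g g' h : M, (g < g')%O -> (g * h < g' * h)%O%g;
  ltg_mul2l : forall g g' h : M, (g < g')%O -> (h * g < h * g')%O%g
}.

#[short(type="strictlyOrderedMonoidType")]
HB.structure Definition StrictlyOrderedMonoid (d : Order.disp_t) :=
  { M of isStrictlyOrderedMonoid d M & monoid.Monoid M & Order.POrder d M }.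

#[short(type="strictlyTotallyOrderedMonoidType")]
HB.structure Definition StrictlyTotallyOrderedMonoid (d : Order.disp_t) :=
  { M of StrictlyOrderedMonoid d M & Order.Total d M }.

(* The additive group of finitely supported functions M -> R is [malg]. Its
   library product is only available over a [monomType], in which 1 is the only
   invertible element, and over a nontrivial R; hence the alias, which carries
   the convolution product for every monoid M and every ring R. *)
Definition monoid_ring (R : pzRingType) (M : monoidType) := {malg R[M]}.

HB.instance Definition _ (R : pzRingType) (M : monoidType) :=
  GRing.Zmodule.on (monoid_ring R M).

(* The element c g of R[M]. *)
Definition mterm (R : pzRingType) (M : monoidType) (c : R) (g : M) :
  monoid_ring R M := mkmalgU g c.

Section MonoidRing.
Variables (R : pzRingType) (M : monoidType).
Implicit Types (x y z : monoid_ring R M) (g h : M).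

Definition mr_one : monoid_ring R M := mterm 1 1%g.

Definition mr_mul x y : monoid_ring R M :=
  \sum_(g <- msupp x) \sum_(h <- msupp y) mterm (x@_g * y@_h) (g * h)%g.

Lemma mterm0 g : mterm (0 : R) g = 0.
Proof. exact: monalgU0. Qed.

Lemma mtermD g : {morph (fun c : R => mterm c g) : a b / a + b}.
Proof. exact: monalgUD. Qed.

Lemma mr_mulw (d1 d2 : {fset M}) x y : msupp x `<=` d1 -> msupp y `<=` d2 ->
  mr_mul x y = \sum_(g <- d1) \sum_(h <- d2) mterm (x@_g * y@_h) (g * h)%g.
Proof.
move=> le_d1 le_d2; rewrite /mr_mul (big_fset_incl _ le_d1) /=.
  apply/eq_bigr=> g _; apply/big_fset_incl => // h _ /mcoeff_outdom ->.
  by rewrite mulr0 mterm0.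
move=> g _ /mcoeff_outdom xg.
by rewrite big1 // => h _; rewrite xg mul0r mterm0.
Qed.

Lemma mr_mulDl : left_distributive mr_mul +%R.
Proof.
move=> x y z; rewrite (mr_mulw (msuppD_le x y) (fsubset_refl _)).
rewrite (mr_mulw (fsubsetUl (msupp x) (msupp y)) (fsubset_refl _)).
rewrite (mr_mulw (fsubsetUr (msupp x) (msupp y)) (fsubset_refl _)).
rewrite -big_split /=; apply/eq_bigr=> g _.
rewrite -big_split /=; apply/eq_bigr=> h _.
by rewrite mcoeffD mulrDl mtermD.
Qed.

Lemma mr_mulDr : right_distributive mr_mul +%R.
Proof.
move=> z x y; rewrite (mr_mulw (fsubset_refl _) (msuppD_le x y)).
rewrite (mr_mulw (fsubset_refl _) (fsubsetUl (msupp x) (msupp y))).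
rewrite (mr_mulw (fsubset_refl _) (fsubsetUr (msupp x) (msupp y))).
rewrite -big_split /=; apply/eq_bigr=> g _.
rewrite -big_split /=; apply/eq_bigr=> h _.
by rewrite mcoeffD mulrDr mtermD.
Qed.

Lemma mr_mul0l : left_zero 0 mr_mul.
Proof. by move=> x; rewrite /mr_mul msupp0 big_seq_fset0. Qed.

Lemma mr_mul0r : right_zero 0 mr_mul.
Proof.
by move=> x; rewrite /mr_mul big1 // => g _; rewrite msupp0 big_seq_fset0.
Qed.

Lemma mr_mulUU (a b : R) g h :
  mr_mul (mterm a g) (mterm b h) = mterm (a * b) (g * h)%g.
Proof. by rewrite (mr_mulw msuppU_le msuppU_le) !big_seq_fset1 !mcoeffUU. Qed.

Lemma mr_expand x : x = \sum_(g <- msupp x) mterm (x@_g) g.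
Proof. exact: monalgE. Qed.

Lemma mr_mul_suml (I : Type) (r : seq I) (F : I -> monoid_ring R M) y :
  mr_mul (\sum_(i <- r) F i) y = \sum_(i <- r) mr_mul (F i) y.
Proof.
by rewrite (big_morph (mr_mul^~ y) (fun _ _ => mr_mulDl _ _ _) (mr_mul0l _)).
Qed.

Lemma mr_mul_sumr (I : Type) (r : seq I) (F : I -> monoid_ring R M) x :
  mr_mul x (\sum_(i <- r) F i) = \sum_(i <- r) mr_mul x (F i).
Proof.
by rewrite (big_morph (mr_mul x) (fun _ _ => mr_mulDr _ _ _) (mr_mul0r _)).
Qed.

Lemma mr_mul1l : left_id mr_one mr_mul.
Proof.
move=> x; rewrite [in LHS](mr_expand x) mr_mul_sumr [RHS]mr_expand.
by apply/eq_bigr=> g _; rewrite mr_mulUU mul1r mul1g.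
Qed.

Lemma mr_mul1r : right_id mr_one mr_mul.
Proof.
move=> x; rewrite [in LHS](mr_expand x) mr_mul_suml [RHS]mr_expand.
by apply/eq_bigr=> g _; rewrite mr_mulUU mulr1 mulg1.
Qed.

Lemma mr_mulA : associative mr_mul.
Proof.
move=> x y z; rewrite (mr_expand x) !mr_mul_suml; apply/eq_bigr=> g _.
rewrite (mr_expand y) mr_mul_suml !mr_mul_sumr mr_mul_suml.
apply/eq_bigr=> h _; rewrite (mr_expand z) !mr_mul_sumr.
by apply/eq_bigr=> k _; rewrite !mr_mulUU mulrA mulgA.
Qed.

HB.instance Definition _ := GRing.Zmodule_isPzRing.Build (monoid_ring R M)
  mr_mulA mr_mul1l mr_mul1r mr_mulDl mr_mulDr.

Lemma mtermM (a b : R) g h :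
  mterm a g * mterm b h = mterm (a * b) (g * h)%g :> monoid_ring R M.
Proof. exact: mr_mulUU. Qed.

End MonoidRing.

Definition in_center (R : pzRingType) (c : R) : Prop :=
  forall r : R, GRing.comm c r.

Definition central_Armendariz (M : monoidType) (R : pzRingType) : Prop :=
  forall (m n : nat) (a : 'I_m -> R) (g : 'I_m -> M)
    (b : 'I_n -> R) (h : 'I_n -> M),
  injective g -> injective h ->
  (\sum_(i < m) mterm (a i) (g i)) * (\sum_(j < n) mterm (b j) (h j)) = 0 ->
  forall (i : 'I_m) (j : 'I_n), in_center (a i * b j).

Definition right_annihilator (S : pzRingType) (a s : S) : Prop := a * s = 0.

Definition principal_right_ideal (S : pzRingType) (f s : S) : Prop :=
  exists t : S, s = f * t.

Definition right_pp (S : pzRingType) : Prop :=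
  forall a : S, exists f : S, f * f = f /\
    forall s : S, right_annihilator a s <-> principal_right_ideal f s.

(* Main.v *)
Require Import Defs.
From mathcomp Require Import all_boot all_order all_algebra.
From mathcomp Require Import fingroup finmap monalg.

(** Write aug(x) for the augmentation (sum of the coefficients) of x in R[M].

    From R[M] to R: the augmentation is a ring retraction of R[M] onto R, so if
    the idempotent f generates the right annihilator of a constant a in R[M],
    then aug(f) is an idempotent that generates the right annihilator of a in R
    ([right_pp_of_monoid_ring]).

    From R to R[M]: the central Armendariz condition makes every idempotent of
    R central. Indeed, for c = e r (1 - e) and g <> 1,
      (e - c g) ((1 - e) + c g) = 0,
    so e c = c is central, and then c = e c = c e = 0
    ([central_Armendariz_abelian]). A right p.p. ring with central idempotents
    is reduced. Over a reduced ring, and with M strictly totally ordered, a zero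
    product x y = 0 forces every product of a coefficient of x by a coefficient of y to
    vanish ([reduced_mcoeffM_eq0]). The right annihilator of x therefore
    consists of the y whose coefficients all lie in the common right annihilator
    in R of the coefficients of x. They are finitely many, and that annihilator
    is generated by the product of the central idempotents attached to each of
    them ([abelian_right_pp_seq]); as a constant, this idempotent generates the
    right annihilator of x. *)

Set Implicit Arguments.
Unset Strict Implicit.
Unset Printing Implicit Defensive.

Import Order.TTheory GRing.Theory.

Local Open Scope ring_scope.

(** * Coefficients and augmentation *)

Lemma mcoeff_mterm (R : pzRingType) (M : monoidType) (c : R) (g k : M) :
  (mterm c g)@_k = c *+ (g == k).
Proof. exact: mcoeffU. Qed.

Lemma mcoeffMr (R : pzRingType) (M : monoidType) (x y : monoid_ring R M)
    (k : M) :
  (x * y)@_k =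
    \sum_(g <- msupp x) \sum_(h <- msupp y) (x@_g * y@_h) *+ (g * h == k)%g.
Proof.
rewrite [x * y]/(mr_mul x y) /mr_mul raddf_sum; apply: eq_bigr => g _.
by rewrite raddf_sum; apply: eq_bigr => h _; exact: mcoeff_mterm.
Qed.

Lemma mcoeff_mtermM1 (R : pzRingType) (M : monoidType) (c : R)
    (y : monoid_ring R M) (k : M) :
  (mterm c 1%g * y)@_k = c * y@_k.
Proof.
rewrite [in LHS](mr_expand y) mulr_sumr raddf_sum [in RHS](mr_expand y).
rewrite raddf_sum mulr_sumr; apply: eq_bigr => h _.
by rewrite mtermM mul1g /= !mcoeff_mterm mulrnAr.
Qed.

Lemma mcoeffM_mterm1 (R : pzRingType) (M : monoidType) (x : monoid_ring R M)
    (c : R) (k : M) :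
  (x * mterm c 1%g)@_k = x@_k * c.
Proof.
rewrite [in LHS](mr_expand x) mulr_suml raddf_sum [in RHS](mr_expand x).
rewrite raddf_sum mulr_suml; apply: eq_bigr => g _.
by rewrite mtermM mulg1 /= !mcoeff_mterm mulrnAl.
Qed.

Definition augmentation (R : pzRingType) (M : monoidType)
  (x : monoid_ring R M) : R := \sum_(g <- msupp x) x@_g.

Lemma augmentationw (R : pzRingType) (M : monoidType) (x : monoid_ring R M)
    (D : {fset M}) :
  fsubset (msupp x) D -> augmentation x = \sum_(g <- D) x@_g.
Proof.
by move=> sxD; apply/big_fset_incl => // g _ /mcoeff_outdom ->.
Qed.

Lemma augmentationD (R : pzRingType) (M : monoidType) :
  {morph @augmentation R M : x y / x + y}.
Proof.
move=> x y; rewrite (augmentationw (msuppD_le x y)).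
rewrite (augmentationw (fsubsetUl (msupp x) (msupp y))).
rewrite (augmentationw (fsubsetUr (msupp x) (msupp y))) -big_split /=.
by apply: eq_bigr => g _; rewrite mcoeffD.
Qed.

Lemma augmentation_mterm (R : pzRingType) (M : monoidType) (c : R) (g : M) :
  augmentation (mterm c g) = c.
Proof. by rewrite (augmentationw msuppU_le) big_seq_fset1 mcoeffUU. Qed.

Lemma augmentation_sum (R : pzRingType) (M : monoidType) (I : Type)
    (r : seq I) (F : I -> monoid_ring R M) :
  augmentation (\sum_(i <- r) F i) = \sum_(i <- r) augmentation (F i).
Proof.
apply: (big_morph _ (@augmentationD R M)).
by rewrite /augmentation msupp0 big_seq_fset0.
Qed.

Lemma augmentationM (R : pzRingType) (M : monoidType) :
  {morph @augmentation R M : x y / x * y}.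
Proof.
move=> x y; rewrite [x * y]/(mr_mul x y) /mr_mul augmentation_sum mulr_suml.
apply: eq_bigr => g _; rewrite augmentation_sum mulr_sumr.
by apply: eq_bigr => h _; rewrite augmentation_mterm.
Qed.

(** Applying the augmentation to the description of the annihilator of the
    constant a in R[M] gives the one in R, because a and s are recovered as the
    augmentations of the corresponding constants. *)
Lemma right_pp_of_monoid_ring (R : pzRingType) (M : monoidType) :
  right_pp (monoid_ring R M) -> right_pp R.
Proof.
move=> ppS a; have [f [ff annf]] := ppS (mterm a 1%g).
exists (augmentation f); split; first by rewrite -augmentationM ff.
move=> s; split=> [as0 | [t ->]].
  have /annf [t def_s] : right_annihilator (mterm a 1%g : monoid_ring R M)
      (mterm s 1%g).
    by rewrite /right_annihilator mtermM as0 mterm0.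
  exists (augmentation t).
  by rewrite -augmentationM -def_s augmentation_mterm.
have /annf af0 : principal_right_ideal f f by exists f.
rewrite /right_annihilator mulrA -[a in LHS](augmentation_mterm a (1%g : M)).
by rewrite -augmentationM af0 /augmentation msupp0 big_seq_fset0 mul0r.
Qed.

(** * Idempotents *)

(** The corner e R (1 - e) squares to zero, so each of its elements c is the
    coefficient of a zero product in R[M]; the two elements 1 and g of the
    monoid keep c apart from the idempotents in the expansion. *)
Lemma central_Armendariz_corner (M : monoidType) (R : pzRingType)
    (g : M) (e r : R) :
  g <> 1%g -> central_Armendariz M R -> e * e = e -> e * r * (1 - e) = 0.
Proof.
move=> g1 armR ee; pose c := e * r * (1 - e).
have e1e : e * (1 - e) = 0 by rewrite mulrBr mulr1 ee subrr.
have oe1 : (1 - e) * e = 0 by rewrite mulrBl mul1r ee subrr.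
have oeoe : (1 - e) * (1 - e) = 1 - e by rewrite mulrBr mulr1 oe1 subr0.
have ec : e * c = c by rewrite /c !mulrA ee.
have ce : c * e = 0 by rewrite /c -!mulrA oe1 !mulr0.
have coe : c * (1 - e) = c by rewrite /c -!mulrA oeoe.
have cc : c * c = 0 by rewrite -{2}ec mulrA ce mul0r.
(* The product to expand is (e - c g) ((1 - e) + c g); its coefficients e and
   c, at 1 and g, make e c central. *)
pose u (i : 'I_2) := if i == 0 then 1%g else g.
have inj_u : injective u.
  by move=> i j; rewrite /u; case: i j => [[|[|i]] hi] [[|[|j]] hj] //= E;
    apply/val_inj => //=; case: g1.
have cen := @armR 2 2 (fun i => if i == 0 then e else - c) u
  (fun i => if i == 0 then 1 - e else c) u inj_u inj_u _ 0 ord_max.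
have /= := cen _ e; rewrite /GRing.comm ec ce => -> //.
rewrite !big_ord_recl !big_ord0 !addr0 /u /=.
rewrite mulrDl !mulrDr !mtermM e1e ec mulNr coe mulNr cc oppr0 !mterm0.
by rewrite mul1g mulg1 add0r addr0 -mtermD subrr mterm0.
Qed.

(** An idempotent is central as soon as both corners e R (1 - e) and
    (1 - e) R e vanish: then e r = e r e = r e. *)
Lemma central_Armendariz_abelian (M : monoidType) (R : pzRingType) (g : M) :
  g <> 1%g -> central_Armendariz M R ->
  forall e : R, e * e = e -> in_center e.
Proof.
move=> g1 armR e ee r; rewrite /GRing.comm.
have oeoe : (1 - e) * (1 - e) = 1 - e.
  by rewrite mulrBr mulr1 mulrBl mul1r ee subrr subr0.
have /eqP := central_Armendariz_corner r g1 armR oeoe.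
have /eqP := central_Armendariz_corner r g1 armR ee.
rewrite subKr mulrBr mulr1 mulrBl mul1r mulrBl !subr_eq0 => /eqP-> /eqP->.
by rewrite -[RHS]mulrA ee.
Qed.

(** * Reduced rings *)

Definition reduced (R : pzRingType) : Prop := forall a : R, a * a = 0 -> a = 0.

Lemma reduced_mulC_eq0 (R : pzRingType) (a b : R) :
  reduced R -> a * b = 0 -> b * a = 0.
Proof.
by move=> redR ab0; apply: redR; rewrite mulrA -(mulrA b) ab0 mulr0 mul0r.
Qed.

(** If a ^ 2 = 0, then a lies in its own annihilator f R, hence a = f a, and
    f a = a f = 0. *)
Lemma abelian_right_pp_reduced (R : pzRingType) :
  (forall e : R, e * e = e -> in_center e) -> right_pp R -> reduced R.
Proof.
move=> abR ppR a aa0; have [f [ff annf]] := ppR a.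
have /annf [t def_a] := aa0.
have af0 : a * f = 0 by apply/annf; exists f.
by rewrite def_a -{1}ff -mulrA -def_a (abR f ff a).
Qed.

Lemma seq_argmin (d : Order.disp_t) (T : eqType) (K : orderType d)
    (f : T -> K) (s : seq T) (x0 : T) :
  x0 \in s -> exists2 x, x \in s & forall y, y \in s -> (f x <= f y)%O.
Proof.
elim: s x0 => // a s IHs x0 _; case: s IHs => [|b s] IHs.
  by exists a; rewrite ?mem_head // => y; rewrite inE => /eqP ->.
have [x xs minx] := IHs b (mem_head _ _).
have [le_ax | lt_xa] := leP (f a) (f x).
  exists a => [|y]; rewrite ?mem_head // inE => /predU1P[-> // | /minx].
  exact: le_trans.
exists x => [|y]; first by rewrite inE xs orbT.
by rewrite inE => /predU1P[-> | /minx //]; exact: ltW.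
Qed.

Lemma leg_mul2l (d : Order.disp_t) (M : strictlyOrderedMonoidType d)
    (h g g' : M) :
  (g <= g')%O -> (h * g <= h * g')%O%g.
Proof.
by rewrite le_eqVlt => /predU1P[-> // | /(ltg_mul2l _ _ h)/ltW].
Qed.

(** Among the pairs (g, h) with x_g y_h <> 0, take one, (g0, h0), with g0 h0
    minimal, and then g0 minimal. Multiply the coefficient of x y at g0 h0 on the
    right by x_g0. A term x_g y_h x_g0 with g h = g0 h0 vanishes when g < g0, by
    the choice of g0; when g > g0, strictness of the order gives h < h0, so that
    x_g0 y_h = 0 by the choice of g0 h0, and y_h x_g0 = 0 since R is reduced;
    when g = g0, left cancellation gives h = h0. Only x_g0 y_h0 x_g0 remains, so
    it is zero and x_g0 y_h0 squares to zero. *)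
Lemma reduced_mcoeffM_eq0 (d : Order.disp_t)
    (M : strictlyTotallyOrderedMonoidType d) (R : pzRingType)
    (x y : monoid_ring R M) :
  reduced R -> x * y = 0 -> forall g h : M, x@_g * y@_h = 0.
Proof.
move=> redR xy0 g1 h1; apply/eqP/negPn/negP => nz1.
pose s := [seq p <- [seq (g, h) | g <- msupp x, h <- msupp y]
               | x@_p.1 * y@_p.2 != 0].
have in_s g h : x@_g * y@_h != 0 -> (g, h) \in s.
  move=> nz; rewrite mem_filter nz; apply/allpairsP; exists (g, h); split=> //.
    by rewrite -mcoeff_neq0; apply: contraNneq nz => ->; rewrite mul0r.
  by rewrite -mcoeff_neq0; apply: contraNneq nz => ->; rewrite mulr0.
(* The lexicographic order on this key performs both minimizations at once. *)
pose key (p : M * M) : M *l M := ((p.1 * p.2)%g, p.1).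
have [[g0 h0]] := seq_argmin key (in_s _ _ nz1).
rewrite mem_filter => /andP[/= nz0 /allpairsP[[g' h'] [/= gx hy [Eg Eh]]]].
subst g' h' => min0.
have lt0 g h : (g * h < g0 * h0)%O%g -> x@_g * y@_h = 0.
  move=> lt; apply/eqP/negPn/negP => /in_s/min0.
  by rewrite /key lexi_pair /= leNgt lt.
have eq0 g h : (g * h = g0 * h0)%g -> (g < g0)%O -> x@_g * y@_h = 0.
  move=> E lt; apply/eqP/negPn/negP => /in_s/min0.
  by rewrite /key lexi_pair /= E lexx /= leNgt lt.
have term0 g h : (g, h) != (g0, h0) ->
    x@_g * y@_h *+ (g * h == g0 * h0)%g * x@_g0 = 0.
  case: (eqVneq (g * h)%g (g0 * h0)%g) => [E|_ _]; last first.
    by rewrite mulr0n mul0r.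
  rewrite mulr1n; case: (ltgtP g g0) => [lt _ | lt _ | Eg].
  - by rewrite eq0 ?mul0r.
  - have lt_h : (h < h0)%O.
      rewrite ltNge; apply/negP => /(leg_mul2l g0) le_h.
      by have := le_lt_trans le_h (ltg_mul2r _ _ h lt); rewrite E ltxx.
    rewrite -mulrA (reduced_mulC_eq0 redR (lt0 g0 h _)) ?mulr0 //.
    exact: ltg_mul2l.
  subst g; rewrite xpair_eqE eqxx /= => neq_h.
  by case: (ltgtP h h0) neq_h => // /(ltg_mul2l _ _ g0); rewrite E ltxx.
suff xyx0 : x@_g0 * y@_h0 * x@_g0 = 0.
  by case/eqP: nz0; apply: redR; rewrite mulrA xyx0 mul0r.
have := congr1 (fun z => z@_(g0 * h0)%g * x@_g0) xy0.
rewrite mcoeff0 mul0r mcoeffMr mulr_suml.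
rewrite (bigD1_seq g0 gx (fset_uniq _)) /=
  [X in _ + X]big1 ?addr0 => [|g ng]; last first.
  rewrite mulr_suml big1 // => h _; apply: term0.
  by rewrite xpair_eqE negb_and ng.
rewrite mulr_suml (bigD1_seq h0 hy (fset_uniq _)) /=
  [X in _ + X]big1 ?addr0 => [|h nh].
  by rewrite eqxx mulr1n.
by apply: term0; rewrite xpair_eqE negb_and nh orbT.
Qed.

(** * Right p.p. monoid rings *)

(** For an idempotent e, the equation e s = s is membership of s in e R; in this
    form the annihilators of the successive elements combine by multiplying
    their commuting idempotents. *)
Lemma abelian_right_pp_seq (R : pzRingType) (l : seq R) :
  (forall e : R, e * e = e -> in_center e) -> right_pp R ->
  exists2 e : R, e * e = e &
    forall s : R, (forall a, a \in l -> a * s = 0) <-> e * s = s.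
Proof.
move=> abR ppR; elim: l => [|a l [e ee IHe]].
  by exists 1; [exact: mul1r | split; rewrite ?mul1r].
have [f [ff annf]] := ppR a.
have fe : GRing.comm f e by exact: abR.
exists (f * e) => [|s]; first by rewrite mulrA -(mulrA f) -fe mulrA ff -mulrA ee.
split=> [ann_s | fes].
  have -> : f * e * s = f * s.
    rewrite -mulrA; congr (_ * _); apply/IHe => b bl.
    by rewrite ann_s // inE bl orbT.
  by have /annf [t ->] := ann_s a (mem_head _ _); rewrite mulrA ff.
have es : e * s = s by rewrite -fes fe !mulrA ee.
move=> b; rewrite inE => /predU1P[-> | bl]; last by apply: (iffRL (IHe s)).
by apply/annf; exists (e * s); rewrite mulrA.
Qed.

Lemma right_pp_monoid_ring (d : Order.disp_t)
    (M : strictlyTotallyOrderedMonoidType d) (R : pzRingType) :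
  (forall e : R, e * e = e -> in_center e) -> right_pp R ->
  right_pp (monoid_ring R M).
Proof.
move=> abR ppR x; have redR := abelian_right_pp_reduced abR ppR.
have [e ee ann_e] := abelian_right_pp_seq [seq x@_g | g <- msupp x] abR ppR.
exists (mterm e 1%g); split=> [|y]; first by rewrite mtermM ee mulg1.
split=> [xy0 | [t ->]].
  exists y; apply/malgP => h; rewrite mcoeff_mtermM1; apply/esym/ann_e.
  by move=> _ /mapP[g _ ->]; exact: reduced_mcoeffM_eq0 xy0 g h.
suff xe0 : x * mterm e 1%g = 0 by rewrite /right_annihilator mulrA xe0 mul0r.
apply/malgP => g; rewrite mcoeffM_mterm1 mcoeff0.
have [gx | /mcoeff_outdom -> ] := boolP (g \in msupp x); last exact: mul0r.
by apply: (iffRL (ann_e e) ee); exact: map_f.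
Qed.

Theorem theorem2p18 (d : Order.disp_t)
    (M : strictlyTotallyOrderedMonoidType d) (R : pzRingType)
    (hM : exists g h : M, g <> h) (hR : central_Armendariz M R) :
  right_pp R <-> right_pp (monoid_ring R M).
Proof.
split=> [ppR|]; last exact: right_pp_of_monoid_ring.
have [g g1] : exists g : M, g <> 1%g.
  have [g [h gh]] := hM; have [E|/eqP g1] := eqVneq g 1%g; last by exists g.
  by exists h => h1; case: gh; rewrite E h1.
exact: right_pp_monoid_ring (central_Armendariz_abelian g1 hR) ppR.
Qed.
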